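(* Let $0<\delta<1$ be arbitrary. Then $$N_{[\ ]}(2,\delta) \le 2\log(2)\,\delta^{-2} + 3(\log(2)+1)\,\delta^{-1} - \left(\frac{13}{9}\log(2)-1\right).$$
   Context: $\log$ is the natural logarithm. For $x,y\in\mathbb{R}^d$, $x\le y$ means componentwise inequality and $[x,y]=[x_1,y_1]\times\cdots\times[x_d,y_d]$. $\lambda_d$ is $d$-dimensional Lebesgue measure. For $A\subseteq[0,1]^d$ and $\delta\in(0,1]$, $N_{[\ ]}(A,\delta)$ is the smallest number of closed boxes $[x,y]$ with $x,y\in[0,1]^d$, $x\le y$, and $\lambda_d([0,y])-\lambda_d([0,x])\le\delta$, whose union contains $A$; $N_{[\ ]}(d,\delta):=N_{[\ ]}([0,1]^d,\delta)$. *)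

(* Defs.v *)
From HB Require Import structures.
From mathcomp Require Import all_boot all_order all_algebra.
From mathcomp Require Import all_classical all_reals all_analysis.
From mathcomp Require Import measurable_realfun.

Set Implicit Arguments.
Unset Strict Implicit.
Unset Printing Implicit Defensive.

Import Order.TTheory GRing.Theory Num.Theory.
Import numFieldNormedType.Exports.

Local Open Scope classical_set_scope.
Local Open Scope ring_scope.

(* Points of R^d are d-tuples. *)
Definition box (R : realType) (d : nat) (x y : d.-tuple R) : set (d.-tuple R) :=
  [set z | forall i : 'I_d, tnth x i <= tnth z i <= tnth y i].

Definition cst_tuple (R : realType) (d : nat) (c : R) : d.-tuple R :=
  [tuple c | i < d].

Definition unit_cube (R : realType) (d : nat) : set (d.-tuple R) :=
  box (cst_tuple d 0) (cst_tuple d 1).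

Arguments unit_cube R d : clear implicits.

(* d-dimensional Lebesgue measure, as the d-fold product of the
   one-dimensional one: R^(d+1) is R x R^d through (t, v) |-> t :: v, and R^0 is
   a point of mass 1.  See lebesgue_measured_box below. *)
Fixpoint lebesgue_measured (R : realType) (d : nat) :
    set (d.-tuple (measurableTypeR R)) -> \bar R :=
  match d return set (d.-tuple (measurableTypeR R)) -> \bar R with
  | 0%N => \d_([tuple] : 0.-tuple (measurableTypeR R))
  | n.+1 => pushforward (@lebesgue_measure R \x @lebesgue_measured R n)%E
              (fun p : measurableTypeR R * n.-tuple (measurableTypeR R) =>
                 [tuple of p.1 :: p.2])
  end.

(* [x, y] is a delta-bracket: a box in the unit cube whose weight, i.e. the
   measure of [0, y] minus that of [0, x], is at most delta. *)
Definition bracket (R : realType) (d : nat) (delta : R) (x y : d.-tuple R) :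
    Prop :=
  [/\ unit_cube R d x, unit_cube R d y,
      forall i : 'I_d, tnth x i <= tnth y i &
      (lebesgue_measured (box (cst_tuple d 0) y)
       - lebesgue_measured (box (cst_tuple d 0) x) <= delta%:E)%E].

Definition bracketing_cover (R : realType) (d : nat) (A : set (d.-tuple R))
    (delta : R) (n : nat) : Prop :=
  exists x y : 'I_n -> d.-tuple R,
    (forall k, bracket delta (x k) (y k)) /\
    A `<=` [set z | exists k, box (x k) (y k) z].

(* The smallest n admitting a cover; the infimum is attained as soon as there
   is one, and is +oo otherwise. *)
Definition bracketing_number (R : realType) (d : nat) (A : set (d.-tuple R))
    (delta : R) : \bar R :=
  ereal_inf [set (n%:R)%:E | n in bracketing_cover A delta].

Lemma lebesgue_measured0 (R : realType) (d : nat) :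
  @lebesgue_measured R d set0 = 0%E.
Proof.
elim: d => [|d IH] /=; first exact: measure0.
rewrite /pushforward /product_measure1 preimage_set0.
by rewrite integral0_eq// => t _ /=; rewrite xsection0 IH.
Qed.

Lemma lebesgue_measured_box (R : realType) (d : nat) (x y : d.-tuple R) :
  (forall i : 'I_d, tnth x i <= tnth y i) ->
  lebesgue_measured (box x y) = (\prod_(i < d) (tnth y i - tnth x i))%:E.
Proof.
elim: d x y => [|d IH] x y xy.
  by rewrite big_ord0 /= diracE mem_set// => -[].
case/tupleP: x y xy => a x; case/tupleP => b y xy.
have ab : a <= b by have := xy ord0; rewrite !tnth0.
have xy' i : tnth x i <= tnth y i by have := xy (lift ord0 i); rewrite !tnthS.
rewrite big_ord_recl !tnth0.
under eq_bigr do rewrite !tnthS.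
rewrite /= /pushforward.
have -> : (fun p : measurableTypeR R * d.-tuple (measurableTypeR R) =>
    [tuple of p.1 :: p.2]) @^-1` box [tuple of a :: x] [tuple of b :: y]
    = `[a, b] `*` box x y.
  apply/seteqP; split=> -[t v] /=.
    move=> h; split=> /=; first by have := h ord0; rewrite !tnth0 in_itv.
    by move=> i; have := h (lift ord0 i); rewrite !tnthS.
  move=> [/=]; rewrite in_itv/= => h1 h2 i.
  by case: (unliftP ord0 i) => [j ->|->]; rewrite ?tnthS ?tnth0.
rewrite /product_measure1.
rewrite (eq_integral (fun t : measurableTypeR R => (\1_`[a, b] t)%:E
    * (\prod_(i < d) (tnth y i - tnth x i))%:E)%E); last first.
  move=> t _ /=; rewrite indicE.
  have [tab|tab] := boolP (t \in `[a, b]%classic).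
    by rewrite in_xsectionX// IH// mul1e.
  by rewrite notin_xsectionX// mul0e lebesgue_measured0.
rewrite ge0_integralZr//.
- rewrite integral_indic// setIT EFinM; congr (_ * _)%E.
  rewrite [LHS](lebesgue_measure_itv `[a, b]) /= lte_fin.
  case: ltP => // ba.
  have -> : b = a by apply/eqP; rewrite eq_le ab ba.
  by rewrite subrr.
- by apply/measurable_EFinP; apply: measurable_indic; exact: measurable_itv.
- by rewrite lee_fin prodr_ge0// => i _; rewrite subr_ge0.
Qed.

(* Main.v *)
(* Cut the unit square into vertical strips of width delta/2, and cover each
   strip from the top downwards by brackets of weight delta.  In the strip over
   [j delta/2, (j+1) delta/2] the distance of the current height to 2 is
   multiplied by (j+1)/j at each step, so that at most (j+1) log 2 + 1 brackets
   bring the height from 1 to 0.  The strips j = 0, 1 together form a single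
   bracket, and summing over the about 2/delta other strips gives the bound. *)

Require Import Defs.
From HB Require Import structures.
From mathcomp Require Import all_boot all_order all_algebra.
From mathcomp Require Import all_classical all_reals all_analysis.
From mathcomp Require Import ring lra.

Import Order.TTheory GRing.Theory Num.Theory.
Local Open Scope ring_scope.

Lemma box2P (R : realType) (a b c d : R) (z : 2.-tuple R) :
  box [tuple a; c] [tuple b; d] z <->
  a <= tnth z ord0 <= b /\ c <= tnth z ord_max <= d.
Proof.
split=> [zbox|[z0 z1] i].
  by split; [have := zbox ord0|have := zbox ord_max]; rewrite !(tnth_nth 0).
have [->|->] : i = ord0 \/ i = ord_max.
  by case: i => -[|[|//]] h; [left|right]; apply/val_inj.
- by move: z0; rewrite !(tnth_nth 0).
- by move: z1; rewrite !(tnth_nth 0).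
Qed.

Lemma unit_cube2 (R : realType) :
  unit_cube R 2 = box [tuple 0; 0] [tuple 1; 1].
Proof.
by rewrite /unit_cube; congr box; apply: eq_from_tnth => -[[|[|//]] h];
  rewrite tnth_mktuple (tnth_nth 0).
Qed.

(** Evaluates the Lebesgue measures once and for all: from here on, weights are differences of
    rectangle areas. *)
Lemma bracket2 (R : realType) (delta a b c d : R) :
  0 <= a <= b -> b <= 1 -> 0 <= c <= d -> d <= 1 -> b * d - a * c <= delta ->
  bracket delta [tuple a; c] [tuple b; d].
Proof.
move=> /andP[a0 ab] b1 /andP[c0 cd] d1 weight.
have nth0 (x y : R) : tnth [tuple x; y] ord0 = x by rewrite (tnth_nth 0).
have nth1 (x y : R) : tnth [tuple x; y] ord_max = y by rewrite (tnth_nth 0).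
have le2 (x y x' y' : R) : x <= x' -> y <= y' ->
    forall i : 'I_2, tnth [tuple x; y] i <= tnth [tuple x'; y'] i.
  by move=> ? ? -[[|[|//]] h]; rewrite !(tnth_nth 0).
have cst2 : cst_tuple 2 (0 : R) = [tuple 0; 0].
  by apply: eq_from_tnth => -[[|[|//]] h]; rewrite tnth_mktuple (tnth_nth 0).
have area (x y : R) : 0 <= x -> 0 <= y ->
    lebesgue_measured (box (cst_tuple 2 0) [tuple x; y]) = (x * y)%:E.
  move=> x0 y0; rewrite cst2 lebesgue_measured_box; last exact: le2.
  rewrite big_ord_recl big_ord1.
  have -> : lift ord0 ord0 = ord_max :> 'I_2 by apply/val_inj.
  by rewrite !nth0 !nth1 !subr0.
split.
- by rewrite unit_cube2; apply/box2P; rewrite nth0 nth1; split; lra.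
- by rewrite unit_cube2; apply/box2P; rewrite nth0 nth1; split; lra.
- exact: le2.
- by rewrite !area ?lee_fin; lra.
Qed.

Lemma bracketing_cover1 {R : realType} {d : nat} {delta : R}
    {x y : d.-tuple R} :
  bracket delta x y -> bracketing_cover (box x y) delta 1.
Proof.
by move=> xy; exists (fun=> x), (fun=> y); split=> // z zxy; exists ord0.
Qed.

Lemma bracketing_coverU {R : realType} {d : nat} {A B C : set (d.-tuple R)}
    {delta : R} {m n : nat} :
  bracketing_cover B delta m -> bracketing_cover C delta n ->
  (A `<=` B `|` C)%classic ->
  bracketing_cover A delta (m + n).
Proof.
move=> [x [y [xy By]]] [x' [y' [xy' Cy]]] ABC.
exists (fun k => match fintype.split k with inl i => x i | inr i => x' i end).
exists (fun k => match fintype.split k with inl i => y i | inr i => y' i end).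
split=> [k|z /ABC [/By|/Cy] [k zk]]; first by case: (fintype.split k).
- by exists (unsplit (inl k)); rewrite unsplitK.
- by exists (unsplit (inr k)); rewrite unsplitK.
Qed.

(* Stacking brackets of full weight downwards, the next height is
   [c = (b * d - delta) / a].  As [b - a = delta / 2], this reads
   [2 - c = (2 - d) * (b / a)], so the distance to 2 grows geometrically. *)
Lemma bracketing_cover_strip (R : realType) (delta a b e d : R) (k : nat) :
  0 < a -> b = a + delta / 2 -> a <= e <= b -> e <= 1 -> 0 <= d <= 1 ->
  2 * (a / b) ^+ k.+1 <= 2 - d ->
  bracketing_cover (box [tuple a; 0] [tuple e; d]) delta k.+1.
Proof.
move=> a0 bE /andP[ae eb] e1; have b0 : 0 < b by lra.
elim: k d => [|k IH] d /andP[d0 d1] height.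
  apply/bracketing_cover1/bracket2; rewrite ?lexx ?d0 ?ae ?(ltW a0)//.
  (* Since [2 * (b - a) = delta], this amounts to [b * d <= delta]: one bracket reaches height 0. *)
  have : 2 * a <= (2 - d) * b.
    by move: height; rewrite expr1 mulrA ler_pdivrMr.
  have : e * d <= b * d by rewrite ler_wpM2r.
  lra.
(* The maximum clips at the bottom edge a bracket that would reach below it. *)
pose c := Num.max 0 ((b * d - delta) / a).
have bdac : b * d - delta <= a * c.
  by rewrite [a * c]mulrC -ler_pdivrMr// /c le_max lexx orbT.
have c0 : 0 <= c by rewrite /c le_max lexx.
have cd : c <= d.
  rewrite /c ge_max d0 ler_pdivrMr//=.
  have : delta * d <= delta * 2 by rewrite ler_wpM2l; lra.
  have -> : b * d = d * a + delta * d / 2 by rewrite bE; ring.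
  lra.
have low : bracketing_cover (box [tuple a; 0] [tuple e; c]) delta k.+1.
  apply: IH; first by rewrite c0 (le_trans cd).
  have ab1 : 0 <= a / b <= 1.
    by rewrite (divr_ge0 (ltW a0) (ltW b0)) ler_pdivrMr// mul1r; lra.
  (* Both arguments of the maximum are bounded: 0 because [a / b <= 1], the other because
     multiplying [height] by [b / a] removes one factor [a / b]. *)
  rewrite lerBrDl -lerBrDr /c ge_max; apply/andP; split.
    have : (a / b) ^+ k.+1 <= 1 by apply: exprn_ile1; lra.
    lra.
  have : 2 * (a / b) ^+ k.+1 * a <= (2 - d) * b.
    by rewrite -ler_pdivrMr//; move: height; rewrite exprSr !mulrA.
  rewrite ler_pdivrMr// mulrBl; lra.
have top : bracket delta [tuple a; c] [tuple e; d].
  apply: bracket2; rewrite ?c0 ?cd ?ae ?(ltW a0)//.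
  have : e * d <= b * d by rewrite ler_wpM2r.
  lra.
rewrite -[k.+2]add1n.
apply: (bracketing_coverU (bracketing_cover1 top) low).
move=> z /box2P[z0 /andP[z1 z1d]].
by have [zc|/ltW cz] := leP (tnth z ord_max) c; [right|left];
  apply/box2P; split=> //; apply/andP.
Qed.

(** Gives the number of brackets that suffice from height 1 in strip [j]. By [1 + t <= expR t] at
    [t = - j.+1%:R^-1], the power is at most [expR (- (k / j.+1))], hence at most 1/2. *)
Lemma double_expr_le1 (R : realType) (j k : nat) :
  ln 2 * j.+1%:R <= k%:R :> R -> 2 * (j%:R / j.+1%:R) ^+ k <= 1 :> R.
Proof.
move=> jk; have j0 : 0 < j.+1%:R :> R by rewrite ltr0n.
have -> : j%:R / j.+1%:R = 1 + - j.+1%:R^-1 :> R.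
  by rewrite -[j.+1%:R]natr1 in j0 *; field; rewrite gt_eqF.
have ge0 : 0 <= 1 + - j.+1%:R^-1 :> R.
  by rewrite subr_ge0 invf_le1// ler1n.
have : (1 + - j.+1%:R^-1) ^+ k <= expR (- ln 2) :> R.
  apply: (@le_trans _ _ (expR (- j.+1%:R^-1) ^+ k)).
    by rewrite lerXn2r ?nnegrE ?expR_ge0 ?expR_ge1Dx.
  rewrite -expRM_natl ler_expR mulrN lerN2 ler_pdivlMr//.
rewrite expRN lnK ?posrE//; lra.
Qed.

(* [(M ^ 2 + M) / 2 - 3] is the sum of [j + 1] for [2 <= j < M = m + 2]. *)
Lemma bracketing_cover_strips (R : realType) (delta : R) (m : nat) :
  0 < delta < 1 -> m.+1%:R * (delta / 2) <= 1 ->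
  exists2 n, bracketing_cover
      (box [tuple 0; 0] [tuple Num.min 1 (m.+2%:R * (delta / 2)); 1]) delta n &
    n%:R <= m.+1%:R + ln 2 * ((m.+2%:R ^+ 2 + m.+2%:R) / 2 - 3) :> R.
Proof.
move=> /andP[delta0 delta1]; elim: m => [|m IH] narrow.
  (* Strips 0 and 1 have total width [delta], so one bracket of full height covers both. The
     geometric argument needs [0 < a], which fails in strip 0. *)
  rewrite (_ : Num.min 1 _ = delta); last first.
    by rewrite mulrC divfK ?pnatr_eq0// min_r// ltW.
  exists 1%N; first by apply/bracketing_cover1/bracket2; lra.
  lra.
set a := m.+2%:R * (delta / 2) in narrow IH *.
set b := m.+3%:R * (delta / 2).
have a0 : 0 < a by rewrite mulr_gt0 ?divr_gt0.
have bE : b = a + delta / 2 by rewrite /a /b -[m.+3%:R]natr1 mulrDl mul1r.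
have [|n cover_n n_le] := IH.
  by apply: le_trans narrow; rewrite ler_wpM2r ?ler_nat ?divr_ge0 ?ltW.
rewrite min_r// in cover_n.
(* The new strip is [j = m.+2]. Rounding down gives both [ln 2 * m.+3%:R < k.+1%:R], so [k.+1]
   brackets suffice, and the count [k.+1%:R <= ln 2 * m.+3%:R + 1]. *)
pose k := Num.truncn (ln 2 * m.+3%:R : R).
have ln2 : 0 < ln 2 :> R by rewrite ln_gt0// ltr1n.
have ab : a / b = m.+2%:R / m.+3%:R.
  by rewrite /a /b -mulf_div divff ?mulr1// gt_eqF ?divr_gt0.
have strip : bracketing_cover
    (box [tuple a; 0] [tuple Num.min 1 b; 1]) delta k.+1.
  (* Here [e] is [Num.min 1 b], as the last strip may overrun the square. *)
  apply: (@bracketing_cover_strip _ _ _ b) => //.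
  - by rewrite ge_min lexx orbT andbT le_min narrow/=; lra.
  - by rewrite ge_min lexx.
  - by rewrite ler01 lexx.
  rewrite ab (le_trans (double_expr_le1 _ _ _ _)) //; last lra.
  by rewrite ltW// truncnS_gt.
exists (n + k.+1)%N.
  apply: (bracketing_coverU cover_n strip) => z /box2P[/andP[z0 z0b] z1].
  by have [za|/ltW az] := leP (tnth z ord0) a; [left|right];
    apply/box2P; split=> //; apply/andP.
have : k%:R <= ln 2 * m.+3%:R :> R.
  by rewrite truncn_le mulr_ge0// ltW.
rewrite natrD; move: n_le; rewrite -[k.+1%:R]natr1 -[m.+3%:R]natr1.
rewrite -[m.+2%:R]natr1; lra.
Qed.

Theorem theorem2p2 (R : realType) (delta : R) (delta_gt0 : 0 < delta)
    (delta_lt1 : delta < 1) :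
  (bracketing_number (unit_cube R 2) delta
   <= (2 * ln 2 * delta ^- 2 + 3 * (ln 2 + 1) * delta^-1
       - (13 / 9 * ln 2 - 1))%:E)%E.
Proof.
have inv_gt1 : 1 < delta^-1 by rewrite invf_gt1.
have ln2 : 0 < ln 2 :> R by rewrite ln_gt0// ltr1n.
(* With this [m], the first [m.+1] strips fit in the square and [m.+2] strips reach past its right
   edge. *)
have [m mE] : exists m, Num.truncn (2 * delta^-1) = m.+1.
  have : (0 < Num.truncn (2 * delta^-1))%N by rewrite truncn_gt0; lra.
  by case: Num.truncn => // m _; exists m.
have m_le : m.+1%:R <= 2 * delta^-1 by rewrite -mE truncn_le; lra.
have m_gt : 2 * delta^-1 < m.+2%:R by rewrite -mE truncnS_gt.
have [||n cover_n n_le] := @bracketing_cover_strips R delta m.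
- by rewrite delta_gt0.
- by rewrite -ler_pdivlMr ?divr_gt0// invf_div mul1r.
rewrite min_l -?unit_cube2 in cover_n; last first.
  by rewrite -ler_pdivrMr ?divr_gt0// invf_div mul1r ltW.
apply: (@le_trans _ _ (n%:R)%:E); first by apply: ereal_inf_lbound; exists n.
rewrite lee_fin (le_trans n_le)//.
rewrite -exprVn -[m.+2%:R]natr1; set x := delta^-1 in inv_gt1 m_le *.
set y := m.+1%:R in m_le *.
have y0 : 0 <= y by rewrite /y.
(* The left side increases with [y >= 0] and equals the right side at [y = 2 * x]. The claim then
   follows with room to spare, from [y <= 2 * x <= 3 * x] and [13 / 9 <= 2]. *)
have : ln 2 * (((y + 1) ^+ 2 + (y + 1)) / 2 - 3) <=
    ln 2 * (2 * x ^+ 2 + 3 * x - 2).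
  by rewrite ler_pM2l//; nra.
lra.
Qed.
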